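(* For all integers $1\le k<n$, \[ r_k(M_n)=\big\|\mathrm{id}:\mathrm{OMIN}_k(M_n)\to M_n\big\|_{cb}=\big\|\mathrm{id}:\mathrm{OMIN}_k(M_n)\to M_n\big\|_{dec}=\frac{2n-k}{k}. \] In particular, every unital $k$-positive map $\phi:M_m\to M_n$ ($m\ge1$) satisfies $\|\phi\|_{cb}\le\frac{2n-k}{k}$.
   Context: An operator system is a closed self-adjoint unital subspace of some $B(H)$ with inherited matrix norms and cones. A linear map $\phi$ is $k$-positive if $\mathrm{id}_k\otimes\phi$ is positive; CP means $k$-positive for all $k$; UCP means unital CP; U$k$P means unital and $k$-positive; $\|\phi\|_{cb}=\sup_k\|\mathrm{id}_k\otimes\phi\|$. $\mathrm{OMIN}_k(\mathcal S)$ denotes $\mathcal S$ with the unique matrix order such that $\mathrm{id}:\mathcal S\to\mathrm{OMIN}_k(\mathcal S)$ is UCP, $\mathrm{id}:\mathrm{OMIN}_k(\mathcal S)\to\mathcal S$ is U$k$P, and for any operator system $\mathcal T$, $\phi:\mathcal T\to\mathcal S$ is U$k$P iff $\phi$ viewed as a map $\mathcal T\to\mathrm{OMIN}_k(\mathcal S)$ is UCP. $r_k(\mathcal S)=\sup\{\|\phi\|_{cb}:\phi:\mathcal T\to\mathcal S\text{ U}k\text{P},\ \mathcal T\text{ any operator system}\}$. For a self-adjoint map $\phi$, $\|\phi\|_{dec}=\inf\{\|\phi^+(I)+\phi^-(I)\|:\phi^\pm\text{ CP},\ \phi=\phi^+-\phi^-\}$. *)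

(* Defs.v *)
From HB Require Import structures.
From mathcomp Require Import all_boot all_order all_algebra.
From mathcomp Require Import complex.
From mathcomp Require Import boolp classical_sets reals constructive_ereal ereal.
Set Implicit Arguments. Unset Strict Implicit. Unset Printing Implicit Defensive.
Import Order.TTheory GRing.Theory Num.Theory.
Local Open Scope ring_scope.
Local Open Scope classical_set_scope.

Section OpSys.
Variable R : realType.
Local Notation C := (R[i]).

Record mos := MOS {
  mcar : lmodType C;
  madj : mcar -> mcar;
  mcone : forall p : nat, 'M[mcar]_p -> Prop;
  munit : mcar }.

Definition madjmx (S : mos) (p q : nat) (X : 'M[mcar S]_(p, q)) : 'M[mcar S]_(q, p) :=
  \matrix_(i, j) @madj S (X j i).

Definition mxscale (S : mos) (p q : nat) (a : C) (X : 'M[mcar S]_(p, q)) : 'M[mcar S]_(p, q) :=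
  map_mx (fun x => a *: x) X.

(* alpha^* X alpha for a scalar matrix alpha in M_{p,q}(C) *)
Definition congr_mx (S : mos) (p q : nat) (alpha : 'M[C]_(p, q)) (X : 'M[mcar S]_p)
  : 'M[mcar S]_q :=
  \matrix_(i, j) \sum_(k < p) \sum_(l < p) (((alpha k i)^* * alpha l j) *: X k l).

Definition eunit (S : mos) (p : nat) : 'M[mcar S]_p :=
  \matrix_(i, j) (if i == j then munit S else 0).

Definition is_opsys (S : mos) : Prop :=
     (forall (a : C) (x y : mcar S), @madj S (a *: x + y) = a^* *: @madj S x + @madj S y)
  /\ (forall x : mcar S, @madj S (@madj S x) = x)
  /\ @madj S (munit S) = munit S
  /\ (forall p (X : 'M[mcar S]_p), @mcone S _ X -> madjmx X = X)
  /\ (forall p (X Y : 'M[mcar S]_p), @mcone S _ X -> @mcone S _ Y -> @mcone S _ (X + Y))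
  /\ (forall p q (alpha : 'M[C]_(p, q)) (X : 'M[mcar S]_p),
        @mcone S _ X -> @mcone S _ (congr_mx alpha X))
  /\ (forall p (X : 'M[mcar S]_p), @mcone S _ X -> @mcone S _ (- X) -> X = 0)
  /\ (forall p (X : 'M[mcar S]_p), madjmx X = X ->
          exists t : R, 0 < t /\ @mcone S _ (mxscale (t%:C)%C (eunit S p) - X))
  /\ (forall p (X : 'M[mcar S]_p),
          (forall e : R, 0 < e -> @mcone S _ (mxscale (e%:C)%C (eunit S p) + X)) -> @mcone S _ X).

Definition mnorm (S : mos) (p : nat) (X : 'M[mcar S]_p) : \bar R :=
  ereal_inf [set (t%:E)%E | t in [set t : R | 0 <= t /\
     @mcone S _ (block_mx (mxscale (t%:C)%C (eunit S p)) X (madjmx X) (mxscale (t%:C)%C (eunit S p)))]].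

Definition enorm (S : mos) (x : mcar S) : \bar R := @mnorm S 1 (const_mx x : 'M[mcar S]_1).

Definition islin (S T : mos) (phi : mcar S -> mcar T) : Prop :=
  forall (a : C) (x y : mcar S), phi (a *: x + y) = a *: phi x + phi y.

Definition unital (S T : mos) (phi : mcar S -> mcar T) : Prop := phi (munit S) = munit T.

Definition kpos (S T : mos) (phi : mcar S -> mcar T) (k : nat) : Prop :=
  forall X : 'M[mcar S]_k, @mcone S _ X -> @mcone T _ (map_mx phi X).

Definition cpos (S T : mos) (phi : mcar S -> mcar T) : Prop := forall k, kpos phi k.

Definition ampnorm (S T : mos) (phi : mcar S -> mcar T) (p : nat) : \bar R :=
  ereal_sup [set @mnorm T p (map_mx phi X) | X in [set X : 'M[mcar S]_p | (@mnorm S p X <= 1)%E]].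

Definition cbnorm (S T : mos) (phi : mcar S -> mcar T) : \bar R :=
  ereal_sup [set ampnorm phi p.+1 | p in [set: nat]].

Definition decnorm (S T : mos) (phi : mcar S -> mcar T) : \bar R :=
  ereal_inf [set x | exists (pp pm : mcar S -> mcar T),
     [/\ islin pp /\ islin pm, cpos pp, cpos pm,
         (forall y, phi y = pp y - pm y) &
         x = @enorm T (pp (munit S) + pm (munit S))]].

Definition rk (k : nat) (S : mos) : \bar R :=
  ereal_sup [set x | exists (T : mos) (phi : mcar T -> mcar S),
     [/\ is_opsys T, islin phi, unital phi, kpos phi k & x = cbnorm phi]].

(* The matrix algebra M_n as an operator system: M_p(M_n)^+ = positive
   semidefinite block matrices (i.e. PSD elements of M_{pn}). *)
Definition cadj (n : nat) (A : 'M[C]_n) : 'M[C]_n := (map_mx Num.conj A)^T.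

Definition psd_block (n p : nat) (X : 'M['M[C]_n]_p) : Prop :=
  (forall i j, X i j = cadj (X j i)) /\
  (forall xi : 'I_p -> 'cV[C]_n,
     0 <= \sum_(i < p) \sum_(j < p) (((map_mx Num.conj (xi i))^T *m X i j *m xi j) 0 0)).

Definition Mn (n : nat) : mos :=
  @MOS ('M[C]_n : lmodType C) (@cadj n) (fun p X => @psd_block n p X) 1%:M.

Definition OMIN (k n : nat) : mos :=
  @MOS ('M[C]_n : lmodType C) (@cadj n)
    (fun p X => forall psi : 'M[C]_n -> 'M[C]_k,
        @islin (Mn n) (Mn k) psi -> @unital (Mn n) (Mn k) psi -> @cpos (Mn n) (Mn k) psi ->
        @psd_block k p (map_mx psi X))
    1%:M.

End OpSys.

(* Main.v *)
(* The identity of [M_n] is [phi_plus - phi_minus] with both maps completely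
   positive on [OMIN k n]. Here [phi_minus] is a diagonal map built from a rank
   [k] projection [P] all of whose diagonal entries are [k / n], and [phi_plus]
   is, up to a positive scalar, the average of [A |-> D P D^* A D P D^*] over
   diagonal unitaries [D]: since [P] factors through an isometry from [C^k],
   every term is completely positive on [OMIN k n]. The maps satisfy
   [phi_plus 1 + phi_minus 1 = (2 n - k) / k], which bounds the decomposable
   norm. A [k]-positive map into [M_n] is completely positive into [OMIN k n],
   so composing with the decomposition bounds its cb-norm in the same way.
   Conversely, [1 - (2 / k) sum_ij e_ij (x) e_ij] has norm at most [1] over
   [OMIN k n], because the Choi matrix of a unital completely positive map into
   [M_k] is positive of trace [k], and its norm over [M_n] is at least
   [2 n / k - 1]. *)
Require Import Defs.
From HB Require Import structures.
From mathcomp Require Import all_boot all_order all_algebra.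
From mathcomp Require Import all_solvable all_field.
From mathcomp Require Import complex ring zify.
From mathcomp Require Import boolp classical_sets reals constructive_ereal ereal.
Import Order.TTheory GRing.Theory Num.Theory.
Set Implicit Arguments. Unset Strict Implicit. Unset Printing Implicit Defensive.
Local Open Scope ring_scope.

(** * Positive sesquilinear forms *)

Section SesquilinearForms.
Variables (C : numClosedFieldType) (I : finType).
Implicit Types (F : I -> I -> C) (x y : I -> C).

Definition sesq F x y : C := \sum_u \sum_v (x u)^* * F u v * y v.

Definition dirac (u : I) : I -> C := fun v => (u == v)%:R.

Lemma sesq_comb F (a b : C) x y :
  sesq F (fun u => a * x u + b * y u) (fun u => a * x u + b * y u) =
  a^* * a * sesq F x x + a^* * b * sesq F x y
  + b^* * a * sesq F y x + b^* * b * sesq F y y.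
Proof.
rewrite /sesq !mulr_sumr -!big_split; apply: eq_bigr => u _ /=.
rewrite !mulr_sumr -!big_split; apply: eq_bigr => v _ /=.
by rewrite rmorphD !rmorphM /=; ring.
Qed.

Lemma sesq_dirac F u v : sesq F (dirac u) (dirac v) = F u v.
Proof.
rewrite /sesq (bigD1 u) //= [X in _ + X]big1 ?addr0; last first.
  move=> i /negPf iu; apply: big1 => j _.
  by rewrite /dirac eq_sym iu rmorph0 !mul0r.
rewrite (bigD1 v) //= [X in _ + X]big1 ?addr0; last first.
  by move=> i /negPf iu; rewrite /dirac [v == i]eq_sym iu mulr0.
by rewrite /dirac !eqxx rmorph1 mul1r mulr1.
Qed.

Lemma sesq_conj F x y : (sesq F x y)^* = sesq (fun u v => (F v u)^*) y x.
Proof.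
rewrite /sesq rmorph_sum /= exchange_big /=; apply: eq_bigr => u _.
rewrite rmorph_sum /=; apply: eq_bigr => v _.
by rewrite !rmorphM /= conjCK; ring.
Qed.

Lemma sesqD F G x y :
  sesq (fun u v => F u v + G u v) x y = sesq F x y + sesq G x y.
Proof.
rewrite /sesq -big_split; apply: eq_bigr => u _.
by rewrite -big_split; apply: eq_bigr => v _ /=; ring.
Qed.

Lemma sesqZ F (a : C) x y :
  sesq (fun u v => a * F u v) x y = a * sesq F x y.
Proof.
rewrite /sesq mulr_sumr; apply: eq_bigr => u _.
by rewrite mulr_sumr; apply: eq_bigr => v _ /=; ring.
Qed.

Lemma sesqN F x y : sesq (fun u v => - F u v) x y = - sesq F x y.
Proof.
rewrite -mulN1r -sesqZ; apply: eq_bigr => u _; apply: eq_bigr => v _.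
by rewrite mulN1r.
Qed.

Lemma sesq_id x : sesq (fun u v => (u == v)%:R) x x = \sum_u (x u)^* * x u.
Proof.
apply: eq_bigr => u _; rewrite (bigD1 u) //= eqxx mulr1 big1 ?addr0 // => v.
by rewrite eq_sym => /negPf ->; rewrite mulr0 mul0r.
Qed.

Lemma sqnorm_ge0 x : 0 <= \sum_u (x u)^* * x u.
Proof. by apply: sumr_ge0 => u _; rewrite mulrC mul_conjC_ge0. Qed.

(** The value at [dirac u + z * dirac v] reduces to [z * F u v + z^* * F v u]; taking [z = 1] and
    [z = 'i] separates the two entries. *)
Lemma polarization F : (forall x, sesq F x x = 0) -> forall u v, F u v = 0.
Proof.
move=> F0 u v.
have e z : z * F u v + z^* * F v u = 0.
  have := F0 (fun w => 1 * dirac u w + z * dirac v w).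
  rewrite sesq_comb !F0 !sesq_dirac rmorph1 !mulr0 !mulr1 !mul1r addr0 add0r.
  by [].
have e1 := e 1; have ei := e 'i.
rewrite rmorph1 !mul1r in e1; rewrite conjCi mulNr -mulrBr in ei.
move/eqP: ei; rewrite mulf_eq0 (negPf (neq0Ci _)) /= subr_eq0 => /eqP ei.
move/eqP: e1; rewrite -ei -mulr2n mulrn_eq0 /= => /eqP //.
Qed.

(** Nonnegative values are real, so the difference of the form and its adjoint vanishes on the
    diagonal and polarization applies. *)
Lemma hermitian_of_ge0 F :
  (forall x, 0 <= sesq F x x) -> forall u v, F u v = (F v u)^*.
Proof.
move=> F0 u v; apply/eqP; rewrite -subr_eq0; apply/eqP.
apply: (@polarization (fun u v => F u v - (F v u)^*)) => x.
rewrite sesqD sesqN -sesq_conj geC0_conj ?subrr //; exact: F0.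
Qed.

(* The difference of the two sides is half the sum over all pairs [(a, b)] of
   the values of the form at [conj (x b) e_a - conj (x a) e_b]. *)
Lemma sesq_le_trace F x : (forall y, 0 <= sesq F y y) ->
  sesq F x x <= (\sum_u F u u) * \sum_u (x u)^* * x u.
Proof.
move=> F0.
have : 0 <= \sum_a \sum_b sesq F
    (fun u => (x b)^* * dirac a u + (- (x a)^*) * dirac b u)
    (fun u => (x b)^* * dirac a u + (- (x a)^*) * dirac b u).
  by apply: sumr_ge0 => a _; apply: sumr_ge0 => b _; apply: F0.
set S := (X in 0 <= X -> _) => S0.
rewrite -subr_ge0; set D := _ - _.
suff SD : S = D + D.
  by move: S0; rewrite SD -mulr2n pmulrn_lge0.
have E : S = \sum_a \sum_b (x b)^* * x b * F a a
   + \sum_a \sum_b (x a)^* * x a * F b b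
   - \sum_a \sum_b (x a)^* * F a b * x b
   - \sum_a \sum_b (x b)^* * F b a * x a.
  rewrite /S -!sumrN -!big_split; apply: eq_bigr => a _ /=.
  rewrite -!sumrN -!big_split; apply: eq_bigr => b _ /=.
  rewrite sesq_comb !sesq_dirac rmorphN /= !conjCK; ring.
have T : \sum_a \sum_b (x b)^* * x b * F a a =
   (\sum_u F u u) * \sum_u (x u)^* * x u.
  rewrite mulr_suml; apply: eq_bigr => a _.
  by rewrite mulr_sumr; apply: eq_bigr => b _; rewrite mulrC.
rewrite E [\sum_a \sum_b (x a)^* * x a * _]exchange_big /= T.
rewrite [X in _ - X]exchange_big /= -/(sesq F x x) /D.
ring.
Qed.

(** A crude entrywise estimate, [|x u| |x v|] being at most the squared norm of [x]; it supplies the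
    order unit axiom for [Mn]. *)
Lemma sesq_order_unit F : (forall u v, F u v = (F v u)^*) ->
  forall x, 0 <= (\sum_u \sum_v `|F u v|) * (\sum_u (x u)^* * x u) - sesq F x x.
Proof.
move=> Fh x.
have Fr : sesq F x x \is Num.real.
  apply/CrealP; rewrite sesq_conj; apply: eq_bigr => u _.
  by apply: eq_bigr => v _; rewrite -Fh.
rewrite subr_ge0; apply: (le_trans (real_ler_norm Fr)).
apply: (le_trans (ler_norm_sum _ _ _)); rewrite mulr_suml.
apply: ler_sum => u _; apply: (le_trans (ler_norm_sum _ _ _)).
rewrite mulr_suml; apply: ler_sum => v _.
rewrite !normrM norm_conjC mulrAC mulrC; apply: ler_wpM2l => //.
have sq w : `|x w| ^+ 2 <= \sum_u (x u)^* * x u.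
  rewrite (bigD1 w) //= normCK mulrC lerDl.
  by apply: sumr_ge0 => i _; rewrite mulrC mul_conjC_ge0.
have := real_leVge (normr_real (x u)) (normr_real (x v)).
case/orP => h.
  by apply: le_trans (sq v); rewrite expr2 ler_wpM2r.
by apply: le_trans (sq u); rewrite expr2 ler_wpM2l.
Qed.

End SesquilinearForms.

(** * Operator systems *)

Lemma split_lshift m n (i : 'I_m) : split (lshift n i) = inl i.
Proof. exact: (unsplitK (inl i)). Qed.

Lemma split_rshift m n (i : 'I_n) : split (rshift m i) = inr i.
Proof. exact: (unsplitK (inr i)). Qed.

(** * Linear maps and scalar congruences *)

Section LinearMaps.
Variables (R : realType) (S T : mos R) (f : mcar S -> mcar T).
Hypothesis lin_f : islin f.

Lemma islin0 : f 0 = 0.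
Proof.
by have := lin_f (-1) 0 0; rewrite scaler0 addr0 scaleN1r addNr.
Qed.

Lemma islinD x y : f (x + y) = f x + f y.
Proof. by have := lin_f 1 x y; rewrite !scale1r. Qed.

Lemma islinZ a x : f (a *: x) = a *: f x.
Proof. by have := lin_f a x 0; rewrite !addr0 islin0 addr0. Qed.

Lemma islinN x : f (- x) = - f x.
Proof. by rewrite -scaleN1r islinZ scaleN1r. Qed.

Lemma islin_sum (I : Type) (r : seq I) (F : I -> mcar S) :
  f (\sum_(i <- r) F i) = \sum_(i <- r) f (F i).
Proof. exact: (big_morph f islinD islin0). Qed.

Lemma map_congr_mx p q (alpha : 'M[R[i]]_(p, q)) (X : 'M[mcar S]_p) :
  map_mx f (congr_mx alpha X) = congr_mx alpha (map_mx f X).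
Proof.
apply/matrixP => i j; rewrite !mxE islin_sum; apply: eq_bigr => k _.
by rewrite islin_sum; apply: eq_bigr => l _; rewrite islinZ mxE.
Qed.

End LinearMaps.

Lemma mxscale1 (R : realType) (S : mos R) p (X : 'M[mcar S]_p) :
  mxscale ((1 : R)%:C)%C X = X.
Proof. by apply/matrixP => i j; rewrite mxE rmorph1 scale1r. Qed.

Lemma ampnorm_le_cbnorm (R : realType) (S T : mos R) (f : mcar S -> mcar T) p :
  (0 < p)%N -> (ampnorm f p <= cbnorm f)%E.
Proof. by case: p => // p _; apply: ereal_sup_ubound; exists p. Qed.

(** * Cones and norms in an abstract operator system *)

Section OperatorSystems.
Variables (R : realType) (S : mos R).
Hypothesis opsysS : is_opsys S.
Local Notation C := R[i].

Lemma cone_adj p (X : 'M[mcar S]_p) : mcone X -> madjmx X = X.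
Proof. by case: opsysS => _ [_ [_ [h _]]]; exact: h. Qed.

Lemma cone_add p (X Y : 'M[mcar S]_p) : mcone X -> mcone Y -> mcone (X + Y).
Proof. by case: opsysS => _ [_ [_ [_ [h _]]]]; exact: h. Qed.

Lemma cone_congr p q (alpha : 'M[C]_(p, q)) (X : 'M[mcar S]_p) :
  mcone X -> mcone (congr_mx alpha X).
Proof. by case: opsysS => _ [_ [_ [_ [_ [h _]]]]]; exact: h. Qed.

Lemma cone_order_unit p (X : 'M[mcar S]_p) : madjmx X = X ->
  exists t : R, 0 < t /\ mcone (mxscale (t%:C)%C (eunit S p) - X).
Proof. by case: opsysS => _ [_ [_ [_ [_ [_ [_ [h _]]]]]]]; exact: h. Qed.

Lemma madjB (x y : mcar S) : madj (x - y) = madj x - madj y.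
Proof.
case: opsysS => h _.
have := h (-1) y x; rewrite scaleN1r addrC => ->.
rewrite rmorphN rmorph1 scaleN1r addrC.
reflexivity.
Qed.

Lemma madj0 : madj (0 : mcar S) = 0.
Proof. by have := madjB 0 0; rewrite !subrr. Qed.

Lemma madjN (x : mcar S) : madj (- x) = - madj x.
Proof. by rewrite -(sub0r x) madjB madj0 sub0r. Qed.

Lemma madjD (x y : mcar S) : madj (x + y) = madj x + madj y.
Proof. by rewrite -{1}(opprK y) madjB madjN opprK. Qed.

(** Congruence by the matrix whose column [i] has the single nonzero entry [c i], in row [f i]. As
    [f] may repeat indices, this covers duplication, sign changes and scaling of blocks. *)
Lemma cone_reindex p q (f : 'I_q -> 'I_p) (c : 'I_q -> C) (X : 'M[mcar S]_p) :
  mcone X -> mcone (\matrix_(i, j) (((c i)^* * c j) *: X (f i) (f j)) : 'M[mcar S]_q).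
Proof.
move=> cX; have := cone_congr (\matrix_(k, i) if k == f i then c i else 0) cX.
congr mcone; apply/matrixP => i j; rewrite !mxE.
rewrite (bigD1 (f i)) //= [X in _ + X]big1 ?addr0; last first.
  move=> k /negPf kf; apply: big1 => l _.
  by rewrite !mxE kf rmorph0 mul0r scale0r.
rewrite (bigD1 (f j)) //= [X in _ + X]big1 ?addr0 ?mxE ?eqxx //.
by move=> l /negPf lf; rewrite !mxE lf mulr0 scale0r.
Qed.

Lemma cone0 p : mcone (0 : 'M[mcar S]_p).
Proof.
have [|t [_ h]] := @cone_order_unit p 0.
  by apply/matrixP => i j; rewrite !mxE madj0.
have := cone_reindex id (fun=> 0) h; congr mcone.
by apply/matrixP => i j; rewrite !mxE mulr0 scale0r.
Qed.

Lemma cone_sum p (I : Type) (r : seq I) (F : I -> 'M[mcar S]_p) :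
  (forall i, mcone (F i)) -> mcone (\sum_(i <- r) F i).
Proof.
by move=> cF; apply: (big_ind (@mcone R S p)) => //; [exact: cone0 | exact: cone_add].
Qed.

Lemma cone_scale p (t : R) (X : 'M[mcar S]_p) :
  0 <= t -> mcone X -> mcone (mxscale (t%:C)%C X).
Proof.
move=> t0 cX; have := cone_reindex id (fun=> ((Num.sqrt t)%:C)%C) cX.
congr mcone; apply/matrixP => i j; rewrite !mxE.
by congr (_ *: _); rewrite geC0_conj ?ler0c ?sqrtr_ge0 // -rmorphM -expr2 sqr_sqrtr.
Qed.

Lemma cone_unit p : mcone (eunit S p).
Proof.
have [|t [t0 h]] := @cone_order_unit p 0.
  by apply/matrixP => i j; rewrite !mxE madj0.
have := @cone_scale _ t^-1 _ _ h; rewrite invr_ge0 ltW // => /(_ isT).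
congr mcone; apply/matrixP => i j.
by rewrite !mxE oppr0 addr0 scalerA -rmorphM mulVf ?(gt_eqF t0) // rmorph1 scale1r.
Qed.

(** The diagonal matrix is the sum over [l] of the congruences of [x] by the [l]-th unit row. *)
Lemma cone_diag p (x : mcar S) : mcone (const_mx x : 'M[mcar S]_1) ->
  mcone (\matrix_(i, j) (if i == j then x else 0) : 'M[mcar S]_p).
Proof.
move=> cx; have := @cone_sum p _ (index_enum 'I_p) (fun l => \matrix_(i, j)
  ((((i == l)%:R : C)^* * (j == l)%:R) *: (const_mx x : 'M[mcar S]_1) 0 0)).
move=> h; have {}h := h (fun l =>
  cone_reindex (fun=> 0) (fun i => ((i == l)%:R : C)) cx).
move: h; congr mcone; apply/matrixP => i j; rewrite summxE mxE (bigD1 i) //= big1.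
  rewrite !mxE eqxx rmorph1 mul1r addr0 eq_sym.
  by case: eqP => _ /=; rewrite ?scale1r ?scale0r.
by move=> l /negPf li; rewrite !mxE eq_sym li rmorph0 mul0r scale0r.
Qed.

Definition unjoin p (i : 'I_(p + p)) : 'I_p :=
  match split i with inl j => j | inr j => j end.

(** Congruence of [X] by the block row [(1, s)] with [s] a sign; [unjoin] folds both halves of the
    index onto one. *)
Lemma cone_block_row p (s : bool) (X : 'M[mcar S]_p) : mcone X ->
  mcone (block_mx X (mxscale ((-1) ^+ s) X) (mxscale ((-1) ^+ s) X) X).
Proof.
move=> cX; have := cone_reindex (@unjoin p)
  (fun i => if split i is inr _ then (-1) ^+ s else 1) cX.
congr mcone; apply/matrixP => i j; rewrite !mxE /unjoin.
case: (split i) => a; rewrite ?mxE; case: (split j) => b; rewrite ?mxE.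
- by rewrite rmorph1 mulr1 scale1r.
- by rewrite rmorph1 mul1r.
- by rewrite rmorphXn rmorphN rmorph1 mulr1.
- by rewrite rmorphXn rmorphN rmorph1 -expr2 sqrr_sign scale1r.
Qed.

Lemma cone_block_opp p (A X Y B : 'M[mcar S]_p) :
  mcone (block_mx A X Y B) -> mcone (block_mx A (- X) (- Y) B).
Proof.
move=> cX; have := cone_reindex id
  (fun i => if split i is inr _ then -1 else 1) cX.
congr mcone; apply/matrixP => i j; rewrite !mxE.
case: (split i) => a; rewrite ?mxE; case: (split j) => b; rewrite ?mxE.
- by rewrite rmorph1 mulr1 scale1r.
- by rewrite rmorph1 mul1r scaleN1r.
- by rewrite rmorphN rmorph1 mulr1 scaleN1r.
- by rewrite rmorphN rmorph1 mulrNN mulr1 scale1r.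
Qed.

Lemma mnorm_le p (t : R) (X : 'M[mcar S]_p) : 0 <= t ->
  mcone (block_mx (mxscale (t%:C)%C (eunit S p)) X
                  (madjmx X) (mxscale (t%:C)%C (eunit S p))) ->
  (mnorm X <= t%:E)%E.
Proof. by move=> t0 cX; apply: ereal_inf_lbound; exists t. Qed.

(** The matrix is half the sum of [E + X] repeated in all four blocks and of [E - X] repeated with a
    minus sign off the diagonal. *)
Lemma cone_block_selfadj p (E X : 'M[mcar S]_p) :
  mcone (E + X) -> mcone (E - X) -> mcone (block_mx E X X E).
Proof.
move=> cp cm.
have := cone_add (cone_block_row false cp) (cone_block_row true cm).
move/(@cone_scale _ 2^-1); rewrite invr_ge0 ler0n => /(_ isT).
congr mcone; rewrite expr0 expr1 add_block_mx.
have e2 (x : mcar S) : ((2^-1 : R)%:C)%C *: (x + x) = x.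
  rewrite -mulr2n -scaler_nat scalerA -(rmorph_nat (real_complex R)) -rmorphM.
  by rewrite mulVf ?rmorph1 ?scale1r // pnatr_eq0.
apply/matrixP => i j; rewrite !mxE.
have E1 (x y : mcar S) : (x + y) + (x - y) = x + x.
  by rewrite addrACA subrr addr0.
have E2 (x y : mcar S) : (x + y) - (x - y) = y + y.
  by rewrite opprB addrC addrA subrK.
by case: (split i) => a; rewrite ?mxE; case: (split j) => b;
  rewrite ?mxE ?scale1r ?scaleN1r ?E1 ?E2 e2.
Qed.

(** Self-adjointness of [X] is inherited from the cone elements [t + X] and [t]. *)
Lemma mnorm_le_selfadj p (t : R) (X : 'M[mcar S]_p) : 0 <= t ->
  mcone (mxscale (t%:C)%C (eunit S p) + X) ->
  mcone (mxscale (t%:C)%C (eunit S p) - X) -> (mnorm X <= t%:E)%E.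
Proof.
move=> t0 cp cm; apply: mnorm_le => //.
suff -> : madjmx X = X by exact: cone_block_selfadj.
have ap := cone_adj cp.
have au := cone_adj (cone_scale t0 (cone_unit p)).
apply/matrixP => i j.
move/matrixP: ap => /(_ i j); move/matrixP: au => /(_ i j).
rewrite !mxE madjD => -> /addrI.
exact.
Qed.

End OperatorSystems.

(** * Comparison of the completely bounded and decomposable norms *)

Section CompletelyBoundedNorm.
Variables (R : realType) (S T : mos R).
Hypotheses (opsysS : is_opsys S) (opsysT : is_opsys T).
Local Notation C := R[i].

Lemma eunit1 (U : mos R) : eunit U 1 = const_mx (munit U).
Proof. by apply/matrixP => i j; rewrite !mxE !ord1. Qed.

Section Decomposition.
Variables pp pm : mcar S -> mcar T.
Hypotheses (lin_pp : islin pp) (lin_pm : islin pm).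
Hypotheses (cpos_pp : cpos pp) (cpos_pm : cpos pm).
Let phi x := pp x - pm x.
Variable t : R.
Hypothesis t_ge0 : 0 <= t.
Hypothesis t_ub : mcone (const_mx ((t%:C)%C *: munit T
  - (pp (munit S) + pm (munit S))) : 'M[mcar T]_1).

(* Positivity of [s, X; X^*, s] is also positivity of [s, -X; -X^*, s]: applying
   [pp] to the former and [pm] to the latter leaves [phi X] off the diagonal. *)
Lemma cone_block_decomposition p (X : 'M[mcar S]_p) (s : R) : 0 <= s ->
  mcone (block_mx (mxscale (s%:C)%C (eunit S p)) X
                  (madjmx X) (mxscale (s%:C)%C (eunit S p))) ->
  mcone (block_mx (mxscale ((t * s)%:C)%C (eunit T p)) (map_mx phi X)
          (madjmx (map_mx phi X)) (mxscale ((t * s)%:C)%C (eunit T p))).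
Proof.
move=> s0 cX.
have c1 := cpos_pp cX.
have c2 := cpos_pm (cone_block_opp opsysS cX).
have c3 := cone_scale opsysT s0 (cone_diag opsysT (p + p) t_ub).
have c := cone_add opsysT (cone_add opsysT c1 c2) c3.
have unit_entry (a b : 'I_p) :
    pp ((s%:C)%C *: (if a == b then munit S else 0))
    + pm ((s%:C)%C *: (if a == b then munit S else 0))
    + (s%:C)%C *: (if a == b then (t%:C)%C *: munit T
        - (pp (munit S) + pm (munit S)) else 0)
    = ((t * s)%:C)%C *: (if a == b then munit T else 0).
  rewrite (islinZ lin_pp) (islinZ lin_pm) -!scalerDr.
  case: eqP => _; last by rewrite (islin0 lin_pp) (islin0 lin_pm) !addr0 !scaler0.
  by rewrite addrC subrK scalerA -rmorphM mulrC.
have E : map_mx pp (block_mx (mxscale (s%:C)%C (eunit S p)) X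
                  (madjmx X) (mxscale (s%:C)%C (eunit S p)))
   + map_mx pm (block_mx (mxscale (s%:C)%C (eunit S p)) (- X)
                  (- madjmx X) (mxscale (s%:C)%C (eunit S p)))
   + mxscale (s%:C)%C (\matrix_(i, j) (if i == j then
       (const_mx ((t%:C)%C *: munit T - (pp (munit S) + pm (munit S)))
         : 'M[mcar T]_1) 0 0 else 0))
   = block_mx (mxscale ((t * s)%:C)%C (eunit T p)) (map_mx phi X)
          (map_mx phi (madjmx X)) (mxscale ((t * s)%:C)%C (eunit T p)).
  apply/matrixP => i j.
  case: (split_ordP i) => a ->; case: (split_ordP j) => b ->;
    rewrite !(mxE, split_lshift, split_rshift).
  - by rewrite eq_lshift unit_entry.
  - by rewrite eq_lrshift scaler0 addr0 (islinN lin_pm).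
  - by rewrite eq_rlshift scaler0 addr0 (islinN lin_pm).
  - by rewrite eq_rshift unit_entry.
have {}c : mcone (block_mx (mxscale ((t * s)%:C)%C (eunit T p)) (map_mx phi X)
          (map_mx phi (madjmx X)) (mxscale ((t * s)%:C)%C (eunit T p))).
  by rewrite -E; move: c; rewrite !mxE.
suff -> : madjmx (map_mx phi X) = map_mx phi (madjmx X) by [].
have := cone_adj opsysT c; move/matrixP => h; apply/matrixP => i j.
have := h (rshift p i) (lshift p j).
by rewrite !(mxE, split_lshift, split_rshift).
Qed.

Lemma cbnorm_le_decomposition (f : mcar S -> mcar T) :
  (forall x, f x = pp x - pm x) -> (cbnorm f <= t%:E)%E.
Proof.
move=> /funext fE; have {fE} -> : f = phi by exact: fE.
apply: ge_ereal_sup => _ [p _ <-]; apply: ge_ereal_sup => _ [X nX <-].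
apply/lee_addgt0Pr => e e0.
have t1 : 0 < t + 1 by apply: ltr_wpDl.
(* A witness [s] slightly above 1 is extracted from the infimum; the denominator [t + 1] gives
   [t * s <= t + e] even when [t = 0]. *)
have : (mnorm X < (1 + e / (t + 1))%:E)%E.
  by apply: (le_lt_trans nX); rewrite lte_fin ltrDl divr_gt0.
case/ereal_inf_lt => _ [s [s0 cX] <-]; rewrite lte_fin => s1.
apply: (@le_trans _ _ (t * s)%:E).
  by apply: mnorm_le; [exact: mulr_ge0 | exact: cone_block_decomposition].
rewrite -EFinD lee_fin; apply: (@le_trans _ _ (t * (1 + e / (t + 1)))).
  by rewrite ler_wpM2l // ltW.
rewrite mulrDr mulr1 lerD2l mulrCA ler_piMr ?(ltW e0) //.
by rewrite ler_pdivrMr // mul1r lerDl.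
Qed.

End Decomposition.

Lemma cbnorm_le_decnorm (f : mcar S -> mcar T) : (cbnorm f <= decnorm f)%E.
Proof.
apply: le_ereal_inf_tmp => _ [pp [pm [[lp lm] cp cm fE ->]]].
apply: le_ereal_inf_tmp => _ [t [t0 ct] <-].
apply: (cbnorm_le_decomposition lp lm cp cm t0 _ fE).
set c := pp (munit S) + pm (munit S) in ct *.
have cS : mcone (const_mx (munit S) : 'M[mcar S]_1).
  by rewrite -eunit1; exact: cone_unit.
have cc : madj c = c.
  have := cone_add opsysT (cp _ _ cS) (cm _ _ cS).
  by move/(cone_adj opsysT)/matrixP/(_ 0 0); rewrite !mxE.
(* Compressing [[t, c; c^*, t]] by the column [(1, -1)] gives [2 (t - c)] since [c] is self-adjoint,
   whence the order bound on [c]. *)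
have := cone_congr opsysT (col_mx 1%:M (-1)%:M : 'M[C]_(1 + 1, 1)) ct.
move/(cone_scale opsysT (t := 2^-1)); rewrite invr_ge0 ler0n => /(_ isT).
congr mcone; apply/matrixP => i j; rewrite !mxE !ord1.
rewrite !big_split_ord !big_ord1 /= !big_split_ord !big_ord1 /=.
rewrite !block_mxEul !block_mxEur !block_mxEdl !block_mxEdr.
rewrite !col_mxEu !col_mxEd !mxE !eqxx /= cc.
rewrite mulr1n rmorphN !rmorph1 mulrNN !mulr1 !mul1r !scale1r !scaleN1r.
rewrite [X in _ + X]addrC -mulr2n -scaler_nat scalerA -(rmorph_nat (real_complex R)).
by rewrite -rmorphM mulVf ?rmorph1 ?scale1r // pnatr_eq0.
Qed.

End CompletelyBoundedNorm.

(** * The operator systems M_n *)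

Section MatrixAlgebras.
Variable R : realType.
Local Notation C := R[i].

Definition ctr m n (A : 'M[C]_(m, n)) : 'M[C]_(n, m) := (map_mx Num.conj A)^T.

Lemma ctrM m n p (A : 'M[C]_(m, n)) (B : 'M[C]_(n, p)) :
  ctr (A *m B) = ctr B *m ctr A.
Proof. by rewrite /ctr map_mxM trmx_mul. Qed.

Lemma ctrK m n (A : 'M[C]_(m, n)) : ctr (ctr A) = A.
Proof. by apply/matrixP => i j; rewrite !mxE conjCK. Qed.

Lemma ctrZ m n (a : C) (A : 'M[C]_(m, n)) : ctr (a *: A) = a^* *: ctr A.
Proof. by apply/matrixP => i j; rewrite !mxE rmorphM. Qed.

Lemma ctr_sum m n (I : Type) (r : seq I) (F : I -> 'M[C]_(m, n)) :
  ctr (\sum_(i <- r) F i) = \sum_(i <- r) ctr (F i).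
Proof.
apply: (big_morph (@ctr m n)) => [A B|]; apply/matrixP => i j; rewrite !mxE.
  exact: rmorphD.
exact: rmorph0.
Qed.

Definition bform n p (X : 'M['M[C]_n]_p) (xi : 'I_p -> 'cV[C]_n) : C :=
  \sum_i \sum_j (ctr (xi i) *m X i j *m xi j) 0 0.

(** The identification of [M_p(M_n)] with matrices indexed by pairs, which brings block forms under
    the lemmas on [sesq]. *)
Definition flat n p (X : 'M['M[C]_n]_p) (u v : 'I_p * 'I_n) : C :=
  X u.1 v.1 u.2 v.2.

Definition flatv n p (xi : 'I_p -> 'cV[C]_n) (u : 'I_p * 'I_n) : C := xi u.1 u.2 0.

Lemma bformE n p (X : 'M['M[C]_n]_p) xi :
  bform X xi = sesq (flat X) (flatv xi) (flatv xi).
Proof.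
rewrite /sesq -(pair_bigA _ (fun i a => \sum_v (flatv xi (i, a))^* *
  flat X (i, a) v * flatv xi v)) /=.
apply: eq_bigr => i _; rewrite exchange_big /=.
rewrite -(pair_bigA _ (fun j b => \sum_a (flatv xi (i, a))^* *
  flat X (i, a) (j, b) * flatv xi (j, b))) /=.
apply: eq_bigr => j _; rewrite !mxE; apply: eq_bigr => b _.
by rewrite !mxE mulr_suml; apply: eq_bigr => a _; rewrite !mxE.
Qed.

Lemma bform_flat n p (X : 'M['M[C]_n]_p) (x : 'I_p * 'I_n -> C) :
  sesq (flat X) x x = bform X (fun i => \col_a x (i, a)).
Proof.
by rewrite bformE; congr sesq; apply/funext => -[i a]; rewrite /flatv mxE.
Qed.

(** Over the complex numbers a form with nonnegative values is Hermitian, which yields the first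
    clause of [psd_block]. *)
Lemma psd_blockP n p (X : 'M['M[C]_n]_p) :
  (forall xi, 0 <= bform X xi) <-> psd_block X.
Proof.
split=> [X0|[_ //]]; split=> // i j; apply/matrixP => a b; rewrite !mxE.
apply: (hermitian_of_ge0 (F := flat X) _ (i, a) (j, b)) => x.
by rewrite bform_flat.
Qed.

Lemma bformD n p (X Y : 'M['M[C]_n]_p) xi :
  bform (X + Y) xi = bform X xi + bform Y xi.
Proof.
rewrite /bform -big_split; apply: eq_bigr => i _; rewrite -big_split.
by apply: eq_bigr => j _; rewrite [(X + Y) i j]mxE mulmxDr mulmxDl mxE.
Qed.

Lemma bformN n p (X : 'M['M[C]_n]_p) xi : bform (- X) xi = - bform X xi.
Proof.
rewrite /bform -sumrN; apply: eq_bigr => i _; rewrite -sumrN.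
by apply: eq_bigr => j _; rewrite [(- X) i j]mxE mulmxN mulNmx mxE.
Qed.

Lemma bformZ m p (c : C) (X : 'M['M[C]_m]_p) xi :
  bform (@mxscale R (Mn R m) _ _ c X) xi = c * bform X xi.
Proof.
rewrite /bform mulr_sumr; apply: eq_bigr => i _.
rewrite mulr_sumr; apply: eq_bigr => j _.
have -> : @mxscale R (Mn R m) _ _ c X i j = c *: X i j by rewrite mxE.
by rewrite -scalemxAr -scalemxAl mxE.
Qed.

(** The vector [xi] is placed in both halves, so that a norm certificate [[t, X; X^*, t]] can be
    tested against the form of [X]. *)
Lemma bform_block_dup m p (A X Y B : 'M['M[C]_m]_p) xi :
  bform (block_mx A X Y B) (fun u => xi (unjoin u)) =
  bform A xi + bform X xi + (bform Y xi + bform B xi).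
Proof.
rewrite /bform big_split_ord /=; congr (_ + _);
  rewrite -big_split; apply: eq_bigr => i _;
  rewrite big_split_ord; congr (_ + _);
  apply: eq_bigr => j _; rewrite /unjoin !(split_lshift, split_rshift).
- by rewrite block_mxEul.
- by rewrite block_mxEur.
- by rewrite block_mxEdl.
- by rewrite block_mxEdr.
Qed.

Lemma bform_eunit n p (t : C) xi :
  bform (mxscale t (eunit (Mn R n) p)) xi =
  t * \sum_u (flatv xi u)^* * flatv xi u.
Proof.
rewrite bformE -sesq_id -sesqZ; congr sesq.
apply/funext => -[i a]; apply/funext => -[j b].
by rewrite /flat !mxE -pair_eqE /pair_eq /=; case: (i == j); rewrite !mxE.
Qed.

Lemma bform_congr n p q (alpha : 'M[C]_(p, q)) (X : 'M['M[C]_n]_p) xi :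
  bform (@congr_mx R (Mn R n) p q alpha X) xi =
  bform X (fun k => \sum_i alpha k i *: xi i).
Proof.
transitivity (\sum_i \sum_j \sum_k \sum_l ((alpha k i)^* * alpha l j) *
   (ctr (xi i) *m X k l *m xi j) 0 0).
  apply: eq_bigr => i _; apply: eq_bigr => j _.
  have -> : @congr_mx R (Mn R n) p q alpha X i j =
      \sum_k \sum_l ((alpha k i)^* * alpha l j) *: X k l by rewrite mxE.
  rewrite mulmx_sumr mulmx_suml summxE; apply: eq_bigr => k _.
  rewrite mulmx_sumr mulmx_suml summxE; apply: eq_bigr => l _.
  by rewrite -scalemxAr -scalemxAl mxE.
transitivity (\sum_k \sum_l \sum_i \sum_j ((alpha k i)^* * alpha l j) *
   (ctr (xi i) *m X k l *m xi j) 0 0).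
  under eq_bigr => i _ do rewrite exchange_big /=.
  rewrite exchange_big /=; apply: eq_bigr => k _.
  under eq_bigr => i _ do rewrite exchange_big /=.
  by rewrite exchange_big.
apply: eq_bigr => k _; apply: eq_bigr => l _.
rewrite ctr_sum !mulmx_suml summxE; apply: eq_bigr => i _.
rewrite mulmx_sumr summxE; apply: eq_bigr => j _.
by rewrite ctrZ -!scalemxAl -scalemxAr !mxE mulrA.
Qed.

Lemma bform_conj n m p (V : 'M[C]_(n, m)) (X : 'M['M[C]_n]_p) xi :
  bform (map_mx (fun A => ctr V *m A *m V) X) xi = bform X (fun i => V *m xi i).
Proof.
apply: eq_bigr => i _; apply: eq_bigr => j _.
by rewrite [map_mx _ _ _ _]mxE ctrM !mulmxA.
Qed.

Lemma bform_eq0 n p (X : 'M['M[C]_n]_p) : (forall xi, bform X xi = 0) -> X = 0.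
Proof.
move=> X0; apply/matrixP => i j; apply/matrixP => a b; rewrite !mxE.
apply: (polarization (F := flat X) _ (i, a) (j, b)) => x.
by rewrite bform_flat.
Qed.

Lemma ge0_real_complex (z : C) : 0 <= z -> exists2 t : R, 0 <= t & z = (t%:C)%C.
Proof.
move=> z0; have /complex_realP[t zE] := ger0_real z0.
by exists t => //; rewrite -ler0c -zE.
Qed.

(** The hypothesis at [e = 1] makes [z] real; the real Archimedean argument then uses [e / (r + 1)],
    where [r] is the real value of [N]. It serves the closure axiom. *)
Lemma real_complex_arch (N z : C) : 0 <= N ->
  (forall e : R, 0 < e -> 0 <= (e%:C)%C * N + z) -> 0 <= z.
Proof.
move=> /ge0_real_complex[r r0 ->] h.
have zr : z \is Num.real.
  have := ger0_real (h 1 ltr01); rewrite rpredDl //.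
  by rewrite -rmorphM; apply: ger0_real; rewrite ler0c mul1r.
have /complex_realP[s zE] := zr; rewrite {}zE {zr} in h *.
rewrite ler0c; apply/ler_addgt0Pr => e e0.
have r1 : 0 < r + 1 by apply: ltr_wpDl.
have := h (e / (r + 1)) (divr_gt0 e0 r1).
rewrite -rmorphM -rmorphD ler0c => /le_trans; apply.
rewrite addrC lerD2l -mulrA ler_piMr ?(ltW e0) //.
by rewrite mulrC ler_pdivrMr // mul1r lerDl.
Qed.

Lemma Mn_opsys n : is_opsys (Mn R n).
Proof.
split=> [a x y|]; first by apply/matrixP => i j; rewrite !mxE rmorphD rmorphM.
split=> [x|]; first by apply/matrixP => i j; rewrite !mxE conjCK.
split; first by apply/matrixP => i j; rewrite !mxE eq_sym rmorph_nat.
split=> [p X [Xh _]|]; first by apply/matrixP => i j; rewrite mxE [RHS]Xh.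
split=> [p X Y /psd_blockP X0 /psd_blockP Y0|].
  by apply/psd_blockP => xi; rewrite bformD addr_ge0.
split=> [p q alpha X /psd_blockP X0|].
  by apply/psd_blockP => xi; rewrite bform_congr.
split=> [p X /psd_blockP X0 /psd_blockP Y0|].
  apply: bform_eq0 => xi; apply/eqP; rewrite eq_le X0 andbT -oppr_ge0 -bformN.
  exact: Y0.
split=> [p X Xh|p X X0].
  have N0 : 0 <= \sum_u \sum_v `|flat X u v|.
    by apply: sumr_ge0 => u _; apply: sumr_ge0.
  have [t t0 tE] := ge0_real_complex N0.
  (* The added 1 makes the order bound strictly positive even when [X] is 0. *)
  exists (t + 1); split; first exact: ltr_wpDl.
  apply/psd_blockP => xi; rewrite bformD bformN bform_eunit.
  have -> : ((t + 1)%:C = t%:C + 1)%C by rewrite rmorphD rmorph1.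
  rewrite mulrDl mul1r -tE addrAC addr_ge0 ?sqnorm_ge0 //.
  rewrite bformE; apply: sesq_order_unit => -[i a] [j b].
  by rewrite /flat -[in LHS]Xh !mxE.
apply/psd_blockP => xi.
apply: (real_complex_arch (sqnorm_ge0 (flatv xi))) => e e0.
rewrite -bform_eunit -bformD.
by have /psd_blockP := X0 e e0; apply.
Qed.

End MatrixAlgebras.

(** * Roots of unity *)

Section RootsOfUnity.
Variable C : numClosedFieldType.

Lemma prim_root_exists n : (0 < n)%N -> {z : C | n.-primitive_root z}.
Proof.
move=> n_gt0; pose p : {poly C} := 'X^n - 1.
have [r Dp] := closed_field_poly_normal p.
rewrite (monicP _) ?monicXnsubC // scale1r in Dp.
have rn1 : all n.-unity_root r by apply/allP=> z; rewrite -root_prod_XsubC -Dp.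
have sz_r : (n < (size r).+1)%N.
  by rewrite -(size_prod_XsubC r id) -Dp size_XnsubC.
have ur : uniq r.
  by rewrite -separable_prod_XsubC -Dp separable_Xn_sub_1 // pnatr_eq0 -lt0n.
by apply/sigW; have /hasP[z _ zP] := has_prim_root n_gt0 rn1 ur sz_r; exists z.
Qed.

Lemma prim_root_neq0 n (z : C) : n.-primitive_root z -> z != 0.
Proof.
move=> zP; apply: contraTneq (prim_order_gt0 zP) => z0; apply/negP => n_gt0.
by have /eqP := prim_expr_order zP; rewrite z0 expr0n (gtn_eqF n_gt0) eq_sym oner_eq0.
Qed.

Lemma prim_root_conj n (z : C) : n.-primitive_root z -> z^* = z^-1.
Proof.
move=> zP; have n0 := prim_order_gt0 zP.
have z1 : `|z| = 1.
  apply/eqP; rewrite -(pexpr_eq1 n0) // -normrX (prim_expr_order zP).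
  by rewrite normr1.
by rewrite invC_norm z1 expr1n invr1 mul1r.
Qed.

(** A geometric sum with ratio [q = z ^ (b - a)]: the ratio is 1 exactly when [a = b], and otherwise
    [q ^ n = 1] annihilates the sum. *)
Lemma sum_prim_root n (z : C) (a b : nat) : n.-primitive_root z ->
  (a < n)%N -> (b < n)%N ->
  \sum_(t < n) (z ^+ (t * a))^* * z ^+ (t * b) = n%:R * (a == b)%:R.
Proof.
move=> zP an bn; have z0 := prim_root_neq0 zP.
pose q := z ^- a * z ^+ b.
transitivity (\sum_(t < n) q ^+ t).
  apply: eq_bigr => t _; rewrite rmorphXn /= (prim_root_conj zP) /q exprMn.
  by rewrite -exprVn -!exprM ![(_ * t)%N]mulnC.
case: (eqVneq a b) => [ab|ab].
  rewrite (eq_bigr (fun=> 1)) ?sumr_const ?card_ord ?mulr1 // => t _.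
  by rewrite /q ab mulVf ?expr1n // expf_neq0.
have q1 : q != 1.
  apply: contra ab => /eqP q1; have : z ^+ a == z ^+ b.
    by rewrite -[z ^+ a]mulr1 -q1 /q mulrA mulfV ?expf_neq0 // mul1r.
  by rewrite (eq_prim_root_expr zP) !modn_small.
have : (q - 1) * \sum_(t < n) q ^+ t = 0.
  rewrite -subrX1 /q exprMn exprVn -!exprM ![(_ * n)%N]mulnC !exprM.
  by rewrite (prim_expr_order zP) !expr1n invr1 mulr1 subrr.
by move/eqP; rewrite mulf_eq0 subr_eq0 (negPf q1) mulr0 /= => /eqP.
Qed.

(* The columns are the first [k] characters of the cyclic group of order [n]. *)
Lemma flat_isometry n k : (0 < n)%N -> (k <= n)%N ->
  exists V : 'M[C]_(n, k),
    (map_mx Num.conj V)^T *m V = n%:R%:M /\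
    forall i, (V *m (map_mx Num.conj V)^T) i i = k%:R.
Proof.
move=> n0 kn; have [w wP] := prim_root_exists n0.
exists (\matrix_(i, s) w ^+ (i * s)); split.
  apply/matrixP => s s'; rewrite !mxE.
  under eq_bigr => i _ do rewrite !mxE.
  rewrite sum_prim_root //; try exact: leq_trans (ltn_ord _) kn.
  by rewrite -(inj_eq val_inj) /= mulr_natr.
move=> i; rewrite !mxE (eq_bigr (fun=> 1)) ?sumr_const ?card_ord // => s _.
rewrite !mxE rmorphXn /= (prim_root_conj wP) exprVn mulfV //.
by rewrite expf_neq0 // (prim_root_neq0 wP).
Qed.

(** The larger exponent is determined: if [j < b], then [2 ^ i + 2 ^ j <= 2 ^ (j + 1) <= 2 ^ b],
    strictly below [2 ^ a + 2 ^ b]. *)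
Lemma sum_pow2_inj i j a b : (i <= j)%N -> (a <= b)%N ->
  (2 ^ i + 2 ^ j = 2 ^ a + 2 ^ b)%N -> (i == a) && (j == b).
Proof.
have H i1 j1 a1 b1 : (i1 <= j1)%N -> (j1 < b1)%N -> (2 ^ i1 + 2 ^ j1 = 2 ^ a1 + 2 ^ b1)%N -> False.
  move=> ij jb; have : (2 ^ i1 <= 2 ^ j1)%N by rewrite leq_exp2l.
  have : (2 ^ j1.+1 <= 2 ^ b1)%N by rewrite leq_exp2l.
  by rewrite expnS; have := expn_gt0 2 a1; lia.
move=> ij ab E.
have jb : j = b.
  case: (ltngtP j b) => // h; first by case: (H _ _ _ _ ij h E).
  by case: (H _ _ _ _ ab h (esym E)).
by move: E; rewrite jb eqxx andbT => /addIn/eqP; rewrite eqn_exp2l.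
Qed.

Lemma sum_pow2_eq i b a j : (2 ^ i + 2 ^ b == 2 ^ a + 2 ^ j)%N =
  ((i == a) && (b == j)) || ((i == j) && (b == a)).
Proof.
apply/eqP/orP => [|[] /andP[/eqP-> /eqP->] //]; last by rewrite addnC.
have [ib|/ltnW bi] := leqP i b; have [aj|/ltnW ja] := leqP a j.
- by move/(sum_pow2_inj ib aj); left.
- by rewrite [RHS]addnC => /(sum_pow2_inj ib ja); right.
- by rewrite [LHS]addnC => /(sum_pow2_inj bi aj); rewrite andbC; right.
- by rewrite [LHS]addnC [RHS]addnC => /(sum_pow2_inj bi ja); rewrite andbC; left.
Qed.

(* The powers of two form a Sidon set, so the exponents [2 ^ i] make the fourth
   moments those of independent uniform phases. *)
Lemma sidon_phases n : exists N (z : 'I_N -> 'I_n -> C),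
  [/\ (0 < N)%N, forall t i, (z t i)^* * z t i = 1 &
   forall i a b j, \sum_t z t i * (z t a)^* * z t b * (z t j)^* =
     N%:R * (((i == a) && (b == j)) || ((i == j) && (b == a)))%:R].
Proof.
(* The order [N] exceeds every sum of two exponents [2 ^ u + 2 ^ v], so equality modulo [N] is
   equality of integers. *)
pose N := (2 ^ n).+1; have [w wP] := @prim_root_exists N isT.
have w0 := prim_root_neq0 wP.
exists N, (fun t i => w ^+ (t * 2 ^ i)); split => // [t i|i a b j].
  by rewrite rmorphXn /= (prim_root_conj wP) exprVn mulVf // expf_neq0.
have small (u v : 'I_n) : (2 ^ u + 2 ^ v < N)%N.
  have n0 : (0 < n)%N by case: (n) u => [[]|].
  have h (x : 'I_n) : (2 ^ x <= 2 ^ n.-1)%N.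
    by rewrite leq_exp2l // -ltnS prednK.
  rewrite /N ltnS -[n in (_ <= 2 ^ n)%N](prednK n0) expnS mul2n -addnn.
  exact: leq_add.
rewrite -!(inj_eq val_inj) /= -sum_pow2_eq eq_sym.
rewrite -(sum_prim_root wP (small a j) (small i b)).
apply: eq_bigr => t _; rewrite !mulnDr !exprD rmorphM /=; ring.
Qed.

End RootsOfUnity.

(** * The operator systems OMIN_k(M_n) *)

Section OMIN.
Variables (R : realType) (n k : nat).
Hypotheses (k_gt0 : (0 < k)%N) (k_ltn : (k < n)%N).
Local Notation C := R[i].

(** Compression by an isometry is a unital completely positive map into [M_k], hence one of the
    tests defining the cone. *)
Lemma omin_bform_isometry p (X : 'M['M[C]_n]_p) (W : 'M[C]_(n, k)) xi :
  @mcone R (OMIN R k n) p X -> ctr W *m W = 1%:M -> 0 <= bform X (fun i => W *m xi i).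
Proof.
move=> cX WW; rewrite -bform_conj.
have /psd_blockP : psd_block (map_mx (fun A : 'M[C]_n => ctr W *m A *m W) X).
  apply: cX => [a x y||q Y /psd_blockP Y0].
  - by rewrite mulmxDr mulmxDl -scalemxAr -scalemxAl.
  - by rewrite /unital /= mulmx1.
  - by apply/psd_blockP => eta; rewrite bform_conj.
exact.
Qed.

(** The map sending [A] to [A a a] times the unit of [M_k] is unital and completely positive; the
    associated test is read along one basis vector of [C^k], available since [k > 0]. *)
Lemma omin_diag_ge0 p (X : 'M['M[C]_n]_p) (a : 'I_n) (x : 'I_p -> C) :
  @mcone R (OMIN R k n) p X -> 0 <= \sum_i \sum_j (x i)^* * X i j a a * x j.
Proof.
move=> cX; pose psi (A : 'M[C]_n) : 'M[C]_k := (A a a)%:M.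
have E q (Y : 'M['M[C]_n]_q) eta : bform (map_mx psi Y) eta =
    \sum_s bform Y (fun i => eta i s 0 *: delta_mx a 0).
  rewrite /bform [RHS]exchange_big /=; apply: eq_bigr => i _.
  rewrite [RHS]exchange_big /=; apply: eq_bigr => j _.
  rewrite [map_mx _ _ _ _]mxE /psi mul_mx_scalar -scalemxAl !mxE mulr_sumr.
  apply: eq_bigr => s _; rewrite ctrZ -!scalemxAl -scalemxAr !mxE.
  rewrite (bigD1 a) //= [X in _ + X]big1 ?addr0; last first.
    by move=> b /negPf ba; rewrite [delta_mx _ _ _ _]mxE ba mulr0.
  rewrite !mxE !eqxx /= mulr1 (bigD1 a) //= [X in _ + X]big1 ?addr0; last first.
    by move=> b /negPf ba; rewrite !mxE ba rmorph0 mul0r.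
  by rewrite !mxE !eqxx rmorph1; ring.
have /psd_blockP h : psd_block (map_mx psi X).
  apply: cX => [c A B||q Y /psd_blockP Y0].
  - by apply/matrixP => i j; rewrite !mxE; case: (i == j);
      rewrite ?mulr1n ?mulr0n ?mulr0 ?addr0.
  - by rewrite /unital /psi /= mxE eqxx.
  - by apply/psd_blockP => eta; rewrite E sumr_ge0.
have := h (fun i => x i *: delta_mx (Ordinal k_gt0) 0); congr (0 <= _).
apply: eq_bigr => i _; apply: eq_bigr => j _.
rewrite [map_mx _ _ _ _]mxE /psi mul_mx_scalar -!scalemxAl -scalemxAr ctrZ.
rewrite -scalemxAl !mxE (bigD1 (Ordinal k_gt0)) //= big1 ?addr0.
  by rewrite !mxE !eqxx /= rmorph1; ring.
by move=> s /negPf sk; rewrite !mxE sk mulr0.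
Qed.

Lemma psd_omin p (X : 'M['M[C]_n]_p) :
  psd_block X -> @mcone R (OMIN R k n) p X.
Proof. by move=> X0 psi _ _; apply. Qed.

(* [k] vectors of [C^k] contract the [p] block indices to [k], so a [k]-positive
   map into [M_k] is completely positive. *)
Lemma kpos_comp_cpos (S : mos R) (phi : mcar S -> mcar (Mn R n)) :
  is_opsys S -> islin phi -> kpos phi k ->
  @cpos R S (OMIN R k n) phi.
Proof.
move=> opsysS lin_phi kphi p X cX psi lin_psi _ cpos_psi.
apply/psd_blockP => xi.
have cZ := cone_congr opsysS (\matrix_(i, s) xi i s 0) cX.
have /psd_blockP := cpos_psi _ _ (kphi _ cZ).
move/(_ (fun s => delta_mx s 0)); congr (0 <= _).
rewrite (map_congr_mx lin_phi) (map_congr_mx lin_psi) bform_congr.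
apply: eq_bigr => i _; apply: eq_bigr => j _.
have e l : \sum_s (\matrix_(i, s) xi i s 0) l s *: delta_mx s 0 = xi l.
  rewrite [RHS]matrix_sum_delta; apply: eq_bigr => s _.
  by rewrite big_ord1 mxE.
by rewrite !e.
Qed.

(** * The decomposition of the identity on [OMIN k n] *)

Section Decomposition.
Variables (N : nat) (V : 'M[C]_(n, k)) (z : 'I_N -> 'I_n -> C).
Hypotheses (VV : ctr V *m V = n%:R%:M) (Vdiag : forall i, (V *m ctr V) i i = k%:R).
Hypothesis N_gt0 : (0 < N)%N.
Hypothesis z_unit : forall t i, (z t i)^* * z t i = 1.
Hypothesis z_moment : forall i a b j,
  \sum_t z t i * (z t a)^* * z t b * (z t j)^* =
     N%:R * (((i == a) && (b == j)) || ((i == j) && (b == a)))%:R.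

Let G := V *m ctr V.
Let w i a := G i a * (G i a)^* / k%:R ^+ 2.

(* [G / n] is the projection [P], and [w i a = (n / k) ^ 2 * |P i a| ^ 2]. *)
Definition phi_minus (A : 'M[C]_n) : 'M[C]_n :=
  \matrix_(i, j) if i == j then \sum_(a | a != i) w i a * A a a else 0.

Definition phi_plus (A : 'M[C]_n) : 'M[C]_n := A + phi_minus A.

Let kC_neq0 : k%:R != 0 :> C.
Proof. by rewrite pnatr_eq0 -lt0n. Qed.

Let n_gt0 : (0 < n)%N. Proof. exact: leq_trans k_ltn. Qed.

Lemma w_ge0 i a : 0 <= w i a.
Proof. by rewrite /w mulr_ge0 ?mul_conjC_ge0 // invr_ge0 exprn_ge0 ?ler0n. Qed.

Lemma phi_minus_lin : @islin R (OMIN R k n) (Mn R n) phi_minus.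
Proof.
move=> c A B; apply/matrixP => i j; rewrite !mxE.
case: eqP => _; last by rewrite mulr0 addr0.
rewrite mulr_sumr -big_split; apply: eq_bigr => a _ /=.
by rewrite !mxE; ring.
Qed.

Lemma phi_plus_lin : @islin R (OMIN R k n) (Mn R n) phi_plus.
Proof.
move=> c A B; rewrite /phi_plus phi_minus_lin scalerDr addrACA.
by [].
Qed.

Lemma phi_minus_cpos : @cpos R (OMIN R k n) (Mn R n) phi_minus.
Proof.
move=> p X cX; apply/psd_blockP => xi.
have -> : bform (map_mx phi_minus X) xi = \sum_b \sum_(a | a != b) w b a *
    \sum_i \sum_j (xi i b 0)^* * (X i j : 'M[C]_n) a a * xi j b 0.
  transitivity (\sum_i \sum_j \sum_b \sum_(a | a != b)
     w b a * ((xi i b 0)^* * (X i j : 'M[C]_n) a a * xi j b 0)).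
    apply: eq_bigr => i _; apply: eq_bigr => j _.
    rewrite [map_mx _ _ _ _]mxE !mxE; apply: eq_bigr => b _.
    rewrite mxE (bigD1 b) //= [X in _ + X]big1 ?addr0; last first.
      by move=> c /negPf cb; rewrite !mxE cb mulr0.
    rewrite !mxE eqxx mulr_sumr mulr_suml; apply: eq_bigr => a _.
    by ring.
  under eq_bigr => i _ do rewrite exchange_big /=.
  rewrite exchange_big /=; apply: eq_bigr => b _.
  under eq_bigr => i _ do rewrite exchange_big /=.
  rewrite exchange_big /=; apply: eq_bigr => a _.
  rewrite mulr_sumr; apply: eq_bigr => i _.
  by rewrite mulr_sumr.
apply: sumr_ge0 => b _; apply: sumr_ge0 => a _.
by rewrite mulr_ge0 ?w_ge0 // omin_diag_ge0.
Qed.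

Let D t : 'M[C]_n := diag_mx (\row_i z t i).
Let B t : 'M[C]_n := D t *m G *m ctr (D t).

Lemma ctrG : ctr G = G.
Proof. by rewrite /G ctrM ctrK. Qed.

Lemma ctrB t : ctr (B t) = B t.
Proof. by rewrite /B ctrM ctrK ctrM ctrG mulmxA. Qed.

Lemma B_entry t i a : B t i a = z t i * G i a * (z t a)^*.
Proof.
rewrite /B /D mul_diag_mx !mxE (bigD1 a) //= [X in _ + X]big1 ?addr0.
  by rewrite !mxE eqxx mulr1n.
move=> b /negPf ba; rewrite !mxE eq_sym.
by rewrite ba mulr0n rmorph0 mulr0.
Qed.

(** Only two pairings of the phases survive the average. The pairing [i = a], [b = j] gives
    [G i i * A i j * G j j], that is [k ^ 2 * A i j]; the pairing [i = j], [a = b] gives the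
    diagonal terms of [phi_minus]. Where both hold the moment counts once, whence the restriction
    [a != i] in [phi_minus]. *)
Lemma sum_conj_B (A : 'M[C]_n) :
  \sum_t ctr (B t) *m A *m B t = (N%:R * k%:R ^+ 2) *: phi_plus A.
Proof.
apply/matrixP => i j; rewrite summxE !mxE.
transitivity (\sum_a \sum_b G i a * A a b * (G j b)^* *
    \sum_t z t i * (z t a)^* * z t b * (z t j)^*).
  transitivity (\sum_t \sum_b \sum_a G i a * A a b * (G j b)^* *
     (z t i * (z t a)^* * z t b * (z t j)^*)).
    apply: eq_bigr => t _; rewrite mxE; apply: eq_bigr => b _.
    rewrite mxE mulr_suml; apply: eq_bigr => a _.
    rewrite ctrB !B_entry -{2}ctrG !mxE; ring.
  rewrite exchange_big /= exchange_big /=.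
  rewrite [RHS]exchange_big /=.
  rewrite exchange_big /=; apply: eq_bigr => b _.
  rewrite exchange_big /=; apply: eq_bigr => a _.
  by rewrite mulr_sumr.
under eq_bigr => a _ do under eq_bigr => b _ do rewrite z_moment.
case: (eqVneq i j) => [<-|ij].
  have only_diag a : \sum_b G i a * A a b * (G i b)^* *
        (N%:R * ((i == a) && (b == i) || (b == a))%:R) =
      G i a * A a a * (G i a)^* * N%:R.
    rewrite (bigD1 a) //= eqxx orbT mulr1 big1 ?addr0 // => b /negPf ba.
    by case: (eqVneq i a) => [->|_]; rewrite ba !mulr0.
  under eq_bigr => a _ do rewrite only_diag.
  rewrite (bigD1 i) //= !Vdiag rmorph_nat mulrDr; congr (_ + _); first by ring.
  rewrite mulr_sumr; apply: eq_bigr => a _; rewrite /w; field.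
  by rewrite kC_neq0.
rewrite addr0 (bigD1 i) //= [X in _ + X]big1 ?addr0; last first.
  by move=> a /negPf ai; apply: big1 => b _; rewrite eq_sym ai !mulr0.
rewrite (bigD1 j) //= big1 ?addr0; last first.
  by move=> b /negPf bj; rewrite bj andbF !mulr0.
by rewrite !eqxx /= !Vdiag rmorph_nat; ring.
Qed.

(** Up to the factor [N * k ^ 2], the form is a sum of forms of [X] at the vectors [B t *m xi i].
    These lie in the range of the isometry [W = D t *m V / sqrt n], because [B t = n W W^*]. *)
Lemma phi_plus_cpos : @cpos R (OMIN R k n) (Mn R n) phi_plus.
Proof.
move=> p X cX; apply/psd_blockP => xi.
have Nk : 0 < N%:R * k%:R ^+ 2 :> C.
  by rewrite mulr_gt0 ?exprn_gt0 ?ltr0n.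
rewrite -(pmulr_rge0 _ Nk).
have -> : N%:R * k%:R ^+ 2 * bform (map_mx phi_plus X) xi =
    \sum_t bform X (fun i => B t *m xi i).
  under [RHS]eq_bigr => t _ do rewrite -bform_conj.
  rewrite /bform [RHS]exchange_big mulr_sumr; apply: eq_bigr => i _ /=.
  rewrite [RHS]exchange_big mulr_sumr; apply: eq_bigr => j _ /=.
  rewrite [map_mx _ _ _ _]mxE.
  under [RHS]eq_bigr => t _ do rewrite [map_mx _ _ _ _]mxE.
  by rewrite -summxE -mulmx_suml -mulmx_sumr sum_conj_B -scalemxAr -scalemxAl [RHS]mxE.
apply: sumr_ge0 => t _.
pose c : C := sqrtC n%:R.
have cc : c * c = n%:R by rewrite -expr2 sqrtCK.
have c0 : c != 0 by rewrite sqrtC_eq0 pnatr_eq0 -lt0n.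
have cr : c^* = c by rewrite geC0_conj // sqrtC_ge0 ler0n.
pose W : 'M[C]_(n, k) := c^-1 *: (D t *m V).
have DD : ctr (D t) *m D t = 1%:M.
  apply/matrixP => i j; rewrite /D mul_mx_diag !mxE eq_sym.
  by case: (i == j); rewrite ?mulr1n ?mulr0n ?rmorph0 ?mul0r.
have WW : ctr W *m W = 1%:M.
  rewrite /W ctrZ ctrM -scalemxAl -scalemxAr scalerA mulmxA.
  rewrite -[ctr V *m _ *m _]mulmxA DD mulmx1 VV fmorphV /= cr.
  rewrite -scalemx1 scalerA -invfM cc mulVf ?scale1r //.
  by rewrite pnatr_eq0 -lt0n.
have := omin_bform_isometry (fun i => c *: (ctr V *m ctr (D t) *m xi i)) cX WW.
congr (0 <= bform X _); apply/funext => i.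
by rewrite /W -scalemxAl -scalemxAr scalerA mulVf // scale1r /B /G !mulmxA.
Qed.

(** From [G ^ 2 = n G], row [i] of [G] has squared norm [n k]; removing the diagonal term [k ^ 2]
    and dividing by [k ^ 2] leaves [(n - k) / k]. *)
Lemma phi_minus1 : phi_minus 1%:M = ((n%:R - k%:R) / k%:R)%:M.
Proof.
apply/matrixP => i j; rewrite !mxE; case: eqP => [_|_]; last by rewrite mulr0n.
have GG : \sum_a G i a * (G i a)^* = n%:R * k%:R.
  transitivity ((G *m ctr G) i i).
    by rewrite mxE; apply: eq_bigr => a _; rewrite !mxE.
  rewrite ctrG /G -mulmxA [ctr V *m _]mulmxA VV.
  by rewrite mul_scalar_mx -scalemxAr mxE Vdiag.
rewrite (eq_bigr (fun a => (G i a * (G i a)^*) / k%:R ^+ 2)); last first.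
  by move=> a _; rewrite mxE eqxx mulr1.
rewrite -mulr_suml mulr1n.
move: GG; rewrite (bigD1 i) //= => /(canRL (addKr _)) ->.
rewrite Vdiag rmorph_nat; field.
by rewrite kC_neq0.
Qed.

End Decomposition.

Lemma omin_decomposition : exists pp pm : 'M[C]_n -> 'M[C]_n,
  [/\ @islin R (OMIN R k n) (Mn R n) pp /\ @islin R (OMIN R k n) (Mn R n) pm,
      @cpos R (OMIN R k n) (Mn R n) pp,
      @cpos R (OMIN R k n) (Mn R n) pm,
      forall A, A = pp A - pm A &
      pp 1%:M + pm 1%:M = (((2 * n - k)%N%:R / k%:R : R)%:C)%C *: 1%:M].
Proof.
have [V [VV Vd]] := @flat_isometry C n k (leq_trans k_gt0 (ltnW k_ltn)) (ltnW k_ltn).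
have [N [z [N0 z1 zm]]] := sidon_phases C n.
exists (phi_plus V), (phi_minus V); split.
- by split; [exact: phi_plus_lin | exact: phi_minus_lin].
- exact: (phi_plus_cpos VV Vd N0 z1 zm).
- exact: phi_minus_cpos.
- by move=> A; rewrite /phi_plus addrK.
rewrite /phi_plus (phi_minus1 VV Vd) scalemx1.
set s : C := (n%:R - k%:R) / k%:R.
transitivity ((1 + s + s)%:M : 'M[C]_n).
  by apply/matrixP => i j; rewrite !mxE !mulrnDl.
congr (_%:M); rewrite /s fmorph_div !rmorph_nat natrB; last by lia.
have k0 : k%:R != 0 :> C by rewrite pnatr_eq0 -lt0n.
by rewrite natrM; field.
Qed.

(** Sums, congruences and the closure axiom are checked test by test, and the order unit comes from
    the smaller cones of [Mn]. Self-adjointness and properness are pulled back from [Mn] through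
    [pp] and [pm], whose difference is the identity. *)
Lemma OMIN_opsys : is_opsys (OMIN R k n).
Proof.
have [pp [pm [[lpp lpm] cpp cpm E _]]] := omin_decomposition.
have [a1 [a2 [a3 [a4 [a5 [a6 [a7 [a8 a9]]]]]]]] := Mn_opsys R n.
have dec p (X : 'M['M[C]_n]_p) : X = map_mx pp X - map_mx pm X.
  by apply/matrixP => i j; rewrite !mxE -E.
have mapD p (X Y : 'M['M[C]_n]_p) (psi : 'M[C]_n -> 'M[C]_k) :
    @islin R (Mn R n) (Mn R k) psi ->
    map_mx psi (X + Y) = map_mx psi X + map_mx psi Y.
  by move=> lpsi; apply/matrixP => i j; rewrite !mxE (islinD lpsi).
split; first exact: a1.
split; first exact: a2.
split; first exact: a3.
split=> [p X cX|].
  have hp := a4 _ _ (cpp _ _ cX); have hm := a4 _ _ (cpm _ _ cX).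
  apply/matrixP => i j; rewrite mxE /= (E (X j i)) [RHS]E.
  move/matrixP/(_ i j): hp; move/matrixP/(_ i j): hm.
  rewrite !mxE /= => <- <-.
  by apply/matrixP => a b; rewrite !mxE rmorphB.
split=> [p X Y cX cY psi l u c|].
  have /psd_blockP hX := cX psi l u c; have /psd_blockP hY := cY psi l u c.
  by apply/psd_blockP => xi; rewrite mapD // bformD addr_ge0.
split=> [p q alpha X cX psi l u c|].
  have /psd_blockP hX := cX psi l u c.
  by apply/psd_blockP => xi; rewrite (map_congr_mx l) bform_congr.
split=> [p X cX cY|].
  have mN (f : 'M[C]_n -> 'M[C]_n) : @islin R (OMIN R k n) (Mn R n) f ->
      map_mx f (- X) = - map_mx f X.
    by move=> lf; apply/matrixP => i j; rewrite !mxE (islinN lf).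
  have pX0 : map_mx pp X = 0.
    apply: (a7 _ _ (cpp _ _ cX)); rewrite -(mN _ lpp).
    exact: (cpp _ _ cY).
  have mX0 : map_mx pm X = 0.
    apply: (a7 _ _ (cpm _ _ cX)); rewrite -(mN _ lpm).
    exact: (cpm _ _ cY).
  by rewrite [LHS]dec pX0 mX0 subrr.
split=> [p X Xh|p X cX psi l u c].
  have [t [t0 ct]] := a8 p X Xh; exists t; split=> //.
  exact: psd_omin.
apply/psd_blockP => xi.
apply: (real_complex_arch (sqnorm_ge0 (flatv xi))) => e e0.
have /psd_blockP/(_ xi) := cX e e0 psi l u c; congr (0 <= _).
rewrite mapD // bformD -bform_eunit; congr (bform _ _ + _).
apply/matrixP => i j; rewrite !mxE (islinZ l).
by case: eqP => _; rewrite ?u ?(islin0 l).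
Qed.

End OMIN.

(** * The norm of the identity *)

Section LowerBound.
Variables (R : realType) (n k : nat).
Hypotheses (k_gt0 : (0 < k)%N) (k_ltn : (k < n)%N).
Local Notation C := R[i].

(** This is [n] times the projection onto the maximally entangled vector; applying [psi] to its
    blocks gives the Choi matrix of [psi]. *)
Definition entangled : 'M['M[C]_n]_n := \matrix_(i, j) delta_mx i j.

Lemma bform_entangled xi :
  bform entangled xi = (\sum_i xi i i 0)^* * \sum_i xi i i 0.
Proof.
rewrite rmorph_sum mulr_suml; apply: eq_bigr => i _.
rewrite mulr_sumr; apply: eq_bigr => j _.
rewrite [entangled _ _]mxE mxE (bigD1 j) //= big1 ?addr0.
  rewrite mxE (bigD1 i) //= big1 ?addr0; first by rewrite !mxE !eqxx mulr1.
  by move=> a /negPf ai; rewrite !mxE ai mulr0.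
move=> a /negPf aj; rewrite mxE big1 ?mul0r // => b _.
by rewrite !mxE aj andbF mulr0.
Qed.

(* A unital map into [M_k] sends the maximally entangled block matrix to one of
   trace [k]. *)
Lemma bform_map_entangled (psi : 'M[C]_n -> 'M[C]_k) xi :
  @islin R (Mn R n) (Mn R k) psi -> @unital R (Mn R n) (Mn R k) psi ->
  @cpos R (Mn R n) (Mn R k) psi ->
  bform (map_mx psi entangled) xi <=
  k%:R * \sum_u (flatv xi u)^* * flatv xi u.
Proof.
move=> lpsi upsi cpsi.
have /psd_blockP h : psd_block (map_mx psi entangled).
  apply: cpsi; apply/psd_blockP => eta.
  by rewrite bform_entangled mulrC mul_conjC_ge0.
have -> : k%:R = \sum_u flat (map_mx psi entangled) u u.
  transitivity (\sum_i \sum_s (psi (delta_mx i i)) s s).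
    have -> : k%:R = \tr (psi 1%:M) by rewrite upsi mxtrace1.
    have -> : 1%:M = \sum_i delta_mx i i :> 'M[C]_n.
      rewrite -diag_const_mx diag_mx_sum_delta; apply: eq_bigr => i _.
      by rewrite mxE scale1r.
    rewrite (islin_sum lpsi) exchange_big; apply: eq_bigr => s _.
    by rewrite summxE.
  rewrite pair_bigA; apply: eq_bigr => -[i s] _.
  by rewrite /flat !mxE.
rewrite bformE; apply: sesq_le_trace => y.
by rewrite bform_flat.
Qed.

Definition extremal : 'M['M[C]_n]_n :=
  eunit (Mn R n) n - @mxscale R (Mn R n) _ _ ((2 / k%:R : R)%:C)%C entangled.

Let ck_ge0 : 0 <= (2 / k%:R : R).
Proof. by rewrite divr_ge0 ?ler0n. Qed.

(** The difference [1 - extremal] is [2 / k] times [entangled], already positive over [M_n]. The sum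
    [1 + extremal] is [2 - (2 / k) entangled], and the coefficient [2 / k] exactly matches the bound
    [k] on the image of [entangled] under each test. *)
Lemma extremal_omin_norm : (@mnorm R (OMIN R k n) n extremal <= 1%:E)%E.
Proof.
apply: (mnorm_le_selfadj (OMIN_opsys R k_gt0 k_ltn)) => //; rewrite mxscale1.
  move=> psi lpsi upsi cpsi; apply/psd_blockP => xi.
  have -> : map_mx psi (eunit (OMIN R k n) n + extremal) =
    @mxscale R (Mn R k) _ _ ((2 : R)%:C)%C (eunit (Mn R k) n)
    - @mxscale R (Mn R k) _ _ ((2 / k%:R : R)%:C)%C (map_mx psi entangled).
    apply/matrixP => i j; rewrite !mxE addrA.
    rewrite (islinD lpsi) (islinN lpsi) (islinZ lpsi) (islinD lpsi).
    congr (_ - _); rewrite rmorph_nat scaler_nat mulr2n.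
    by case: eqP => _; rewrite ?upsi // (islin0 lpsi).
  rewrite bformD bformN bform_eunit bformZ subr_ge0.
  have -> : ((2 : R)%:C = (2 / k%:R : R)%:C * k%:R)%C.
    rewrite -(rmorph_nat (real_complex R) k) -rmorphM divfK //.
    by rewrite pnatr_eq0 -lt0n.
  rewrite -mulrA ler_wpM2l ?ler0c //.
  exact: bform_map_entangled.
apply: psd_omin; apply/psd_blockP => xi.
rewrite /extremal opprB addrC subrK bformZ mulr_ge0 ?ler0c //.
by rewrite bform_entangled mulrC mul_conjC_ge0.
Qed.

(** The vector [e] is the maximally entangled one, an eigenvector of [entangled] for the eigenvalue
    [n]. Placed in both halves, it turns any norm certificate [t] into
    [0 <= 2 n (t + 1 - 2 n / k)]. *)
Lemma extremal_norm :
  ((((2 * n - k)%N%:R / k%:R : R)%:E)%E <= @mnorm R (Mn R n) n extremal)%E.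
Proof.
apply: le_ereal_inf_tmp => _ [t [t0 /psd_blockP ct] <-]; rewrite lee_fin.
pose e (i : 'I_n) : 'cV[C]_n := delta_mx i 0.
have := ct (fun u => e (unjoin u)).
have -> : madjmx (extremal : 'M[mcar (Mn R n)]_n) = extremal.
  apply/matrixP => i j; apply/matrixP => a b; rewrite !mxE.
  rewrite rmorphB rmorphM [j == i]eq_sym.
  congr (_ - _).
    by case: (i == j); rewrite !mxE ?rmorph0 // eq_sym rmorph_nat.
  by rewrite /= geC0_conj ?ler0c // conjC_nat andbC.
have sq : \sum_u (flatv e u)^* * flatv e u = n%:R.
  rewrite -(pair_bigA _ (fun i a => (flatv e (i, a))^* * flatv e (i, a))) /=.
  rewrite (eq_bigr (fun=> 1)) ?sumr_const ?card_ord // => i _.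
  rewrite (bigD1 i) //= big1 ?addr0.
    by rewrite /flatv !mxE !eqxx rmorph1 mulr1.
  by move=> a /negPf ai; rewrite /flatv !mxE ai mulr0.
have be : bform entangled e = n%:R * n%:R.
  rewrite bform_entangled (eq_bigr (fun=> 1)).
    by rewrite sumr_const card_ord rmorph_nat.
  by move=> i _; rewrite !mxE !eqxx.
have bx : bform extremal e = n%:R - ((2 / k%:R : R)%:C)%C * (n%:R * n%:R).
  rewrite /extremal bformD bformN bformZ be; congr (_ - _).
  by rewrite -(mxscale1 (eunit _ _)) bform_eunit sq rmorph1 mul1r.
rewrite bform_block_dup bform_eunit sq bx.
rewrite -!(rmorph_nat (real_complex R)) -!(rmorphM, rmorphB, rmorphD) ler0c /= natrM.
have n0 : 0 < n%:R :> R by rewrite ltr0n; exact: leq_trans k_ltn.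
have k0 : 0 < k%:R :> R by rewrite ltr0n.
have -> : t * n%:R + (n%:R - 2 / k%:R * (n%:R * n%:R)) +
   (n%:R - 2 / k%:R * (n%:R * n%:R) + t * n%:R) =
   2 * n%:R * (t + 1 - 2 * n%:R / k%:R).
  by field; rewrite gt_eqF.
rewrite pmulr_rge0; last by rewrite mulr_gt0.
rewrite natrB; last by lia.
rewrite natrM mulrBl divff ?gt_eqF // subr_ge0 lerBlDr.
by [].
Qed.

Lemma cbnorm_omin_ge :
  ((((2 * n - k)%N%:R / k%:R : R)%:E)%E <=
   cbnorm (fun x : mcar (OMIN R k n) => (x : mcar (Mn R n))))%E.
Proof.
apply: le_trans (ampnorm_le_cbnorm _ (leq_trans k_gt0 (ltnW k_ltn))).
apply: (le_trans extremal_norm); apply: ereal_sup_ubound.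
exists extremal; first exact: extremal_omin_norm.
by congr mnorm; apply/matrixP => i j; rewrite mxE.
Qed.

End LowerBound.

(** * The upper bound *)

Section UpperBound.
Variables (R : realType) (n k : nat).
Hypotheses (k_gt0 : (0 < k)%N) (k_ltn : (k < n)%N).
Let r : R := (2 * n - k)%N%:R / k%:R.

Let r_ge0 : 0 <= r.
Proof. by rewrite divr_ge0 ?ler0n. Qed.

Lemma cbnorm_kpos_le (S : mos R) (phi : mcar S -> mcar (Mn R n)) :
  is_opsys S -> islin phi -> unital phi -> kpos phi k ->
  (cbnorm phi <= r%:E)%E.
Proof.
move=> opsysS lphi uphi kphi.
have [pp [pm [[lpp lpm] cpp cpm E Er]]] := omin_decomposition R k_gt0 k_ltn.
have cphi := kpos_comp_cpos opsysS lphi kphi.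
apply: (@cbnorm_le_decomposition R S (Mn R n) opsysS (Mn_opsys R n)
  (pp \o phi) (pm \o phi) _ _ _ _ r r_ge0) => /=.
- by move=> a x y /=; rewrite lphi lpp.
- by move=> a x y /=; rewrite lphi lpm.
- by move=> p X cX; rewrite map_mx_comp; exact: cpp (cphi _ _ cX).
- by move=> p X cX; rewrite map_mx_comp; exact: cpm (cphi _ _ cX).
(* By unitality the two maps add up to exactly [r] at the unit, so the required positive element is
   0. *)
- rewrite uphi /= Er subrr; exact: (cone0 (Mn_opsys R n)).
- by move=> x; exact: E.
Qed.

Lemma decnorm_omin_le :
  (decnorm (fun x : mcar (OMIN R k n) => (x : mcar (Mn R n))) <= r%:E)%E.
Proof.
have [pp [pm [lin_pm cpp cpm E Er]]] := omin_decomposition R k_gt0 k_ltn.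
apply: ge_ereal_inf; exists (enorm (pp (munit (OMIN R k n)) + pm (munit (OMIN R k n)) : mcar (Mn R n))).
  by exists pp, pm; split.
rewrite /= Er /enorm.
have -> : const_mx ((r%:C)%C *: 1%:M) = mxscale (r%:C)%C (eunit (Mn R n) 1).
  by apply/matrixP => i j; rewrite !mxE !ord1.
have cr := cone_scale (Mn_opsys R n) r_ge0 (cone_unit (Mn_opsys R n) 1).
apply: (mnorm_le_selfadj (Mn_opsys R n) r_ge0).
  exact: (cone_add (Mn_opsys R n) cr cr).
by rewrite subrr; exact: (cone0 (Mn_opsys R n)).
Qed.

(** Gram-Schmidt on the [k] vectors, possible because [k < n], gives an orthonormal family whose
    span contains them even when they are dependent. *)
Lemma isometry_span (xi : 'I_k -> 'cV[R[i]]_n) : exists (W : 'M[R[i]]_(n, k))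
  (eta : 'I_k -> 'cV[R[i]]_k), ctr W *m W = 1%:M /\ forall i, xi i = W *m eta i.
Proof.
pose A : 'M[R[i]]_(k, n) := \matrix_(i, a) xi i a 0.
pose B := schmidt A.
have /unitarymxP BB : B \is unitarymx by exact: schmidt_unitarymx (ltnW k_ltn).
have AB : A = A *m pinvmx B *m B by rewrite mulmxKpV // schmidt_sub.
exists B^T, (fun i => (row i (A *m pinvmx B))^T); split.
  (* The rows of [B] are orthonormal; for [W = B^T] the relation needed is the entrywise conjugate
     of this one. *)
  move/(congr1 (map_mx Num.conj)): BB; rewrite map_mxM map_mx1 => <-.
  congr (_ *m _); first by apply/matrixP => i j; rewrite !mxE.
  by apply/matrixP => i j; rewrite !mxE /= conjCK.
move=> i; rewrite -trmx_mul -row_mul -AB.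
by apply/matrixP => a b; rewrite !mxE ord1.
Qed.

(** At level [k] a form is tested on only [k] vectors, which share the range of one isometry from
    [C^k]. The identity is thus admissible in the supremum defining [rk]. *)
Lemma omin_id_kpos :
  kpos (fun x : mcar (OMIN R k n) => (x : mcar (Mn R n))) k.
Proof.
move=> X cX; have -> : map_mx (fun x => x) X = X.
  by apply/matrixP => i j; rewrite mxE.
apply/psd_blockP => xi; have [W [eta [WW E]]] := isometry_span xi.
have -> : xi = (fun i => W *m eta i) by exact/funext.
exact: omin_bform_isometry.
Qed.

End UpperBound.

Theorem mainTheorem3 (R : realType) (n k : nat) (hk1 : (1 <= k)%N) (hkn : (k < n)%N) :
  let r : \bar R := (((2 * n - k)%N%:R / k%:R : R)%:E)%E in
  [/\ rk k (Mn R n) = r,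
      cbnorm (fun x : mcar (OMIN R k n) => (x : mcar (Mn R n))) = r,
      decnorm (fun x : mcar (OMIN R k n) => (x : mcar (Mn R n))) = r &
      forall (m : nat), (1 <= m)%N ->
        forall phi : mcar (Mn R m) -> mcar (Mn R n),
          islin phi -> unital phi -> kpos phi k -> (cbnorm phi <= r)%E].
Proof.
move=> r.
have opsysO := OMIN_opsys R hk1 hkn.
pose iota (x : mcar (OMIN R k n)) : mcar (Mn R n) := x.
(* The cycle [r <= cbnorm iota <= decnorm iota <= r] forces equality throughout. *)
have cb_ge : (r <= cbnorm iota)%E := cbnorm_omin_ge R hk1 hkn.
have cb_dec : (cbnorm iota <= decnorm iota)%E.
  exact: cbnorm_le_decnorm opsysO (Mn_opsys R n) _.
have dec_le : (decnorm iota <= r)%E := decnorm_omin_le R hk1 hkn.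
split.
- apply/eqP; rewrite eq_le; apply/andP; split.
    apply: ge_ereal_sup => _ [S [phi [opsysS lphi uphi kphi ->]]].
    exact: cbnorm_kpos_le.
  apply: (le_trans cb_ge); apply: ereal_sup_ubound.
  exists (OMIN R k n), iota; split => //.
  exact: omin_id_kpos.
- by apply/eqP; rewrite eq_le cb_ge (le_trans cb_dec dec_le).
- by apply/eqP; rewrite eq_le dec_le (le_trans cb_ge cb_dec).
move=> m _ phi lphi uphi kphi.
exact: cbnorm_kpos_le (Mn_opsys R m) lphi uphi kphi.
Qed.
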